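(* Let $1\le m\le n$ be integers and let $H$ be a maximal clique in the Johnson graph $G = J_n(m,m-1)$. If $|\nu(v_1)\cap\nu(v_2)\cap\nu(v_3)| = m-1$ for some distinct nodes $v_1,v_2,v_3\in V(H)$, then $$\bigcap_{v\in V(H)}\nu(v) = \nu(v_1)\cap\nu(v_2).$$
   Context: $[n]=\{1,2,\ldots,n\}$ and $\binom{[n]}{m}$ is the collection of all $m$-element subsets of $[n]$. The Johnson graph $J_n(m,m-1)$ is the simple undirected graph with $\binom{n}{m}$ nodes, each node $v$ labelled by a unique set $\nu(v)\in\binom{[n]}{m}$ (so $\nu$ is a bijection from nodes to $\binom{[n]}{m}$), in which distinct nodes $v_i,v_j$ are adjacent if and only if $|\nu(v_i)\cap\nu(v_j)| = m-1$. A clique is a complete subgraph (identified with its vertex set $V(H)$); a clique is maximal if no strictly larger clique contains it. *)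

(* Defs.v *)
From mathcomp Require Import all_boot.

Set Implicit Arguments.
Unset Strict Implicit.
Unset Printing Implicit Defensive.

(* The ground set [n] = {1, ..., n} is represented by 'I_n = {0, ..., n-1}. *)
Notation msubset n m := {A : {set 'I_n} | #|A| == m}.

(* Adjacency of J_n(m, m-1), on a node type V labelled by nu; the labelling is
   meant to be bijective.  Since m.-1 is 0 for m = 0, this is intended for
   0 < m. *)
Definition johnson_adj (n m : nat) (V : finType) (nu : V -> msubset n m) :
    rel V :=
  fun u v => (u != v) && (#|val (nu u) :&: val (nu v)| == m.-1).

Definition clique (V : finType) (e : rel V) (H : {set V}) : bool :=
  [forall u in H, forall v in H, (u != v) ==> e u v].

Definition maximal_clique (V : finType) (e : rel V) (H : {set V}) : bool :=
  maxset (clique e) H.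

(* Main.v *)
Require Import Defs.
From mathcomp Require Import all_boot zify.

(** Let S be the intersection of the labels of v1 and v2.  Since S has m - 1 elements and meets the label of v3 in m - 1
    elements, it lies in all three labels, and by cardinality it is the
    intersection of any two of them: the three labels form a sunflower with
    kernel S.  An m-set A meeting each of them in at least m - 1 elements
    then contains S (lemma [sunflower3_kernel_sub]): the three traces on A form
    a sunflower with kernel A :&: S, whose union has at most m elements, so
    3 (m - 1) - 2 |A :&: S| <= m, which by integrality forces
    |A :&: S| >= m - 1 = |S|.  Labels of clique members are such sets A, so S
    lies in the label of every v in H; the opposite inclusion holds because v1
    and v2 belong to H. *)

Lemma card_sunflower3 (T : finType) (A1 A2 A3 S : {set T}) :
  A1 :&: A2 = S -> A1 :&: A3 = S -> A2 :&: A3 = S ->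
  #|A1 :|: A2 :|: A3| + #|S| + #|S| = #|A1| + #|A2| + #|A3|.
Proof.
move=> e12 e13 e23.
have := cardsUI (A1 :|: A2) A3; rewrite setIUl e13 e23 setUid.
have := cardsUI A1 A2; rewrite e12; lia.
Qed.

(** A set A missing part of S would need a point in each of the three petals,
    and would then be too large.  Two petals do not suffice: for m >= 2, A can
    trade one point of S for the two petals. *)
Lemma sunflower3_kernel_sub (T : finType) (m : nat)
    (A1 A2 A3 S A : {set T}) :
  A1 :&: A2 = S -> A1 :&: A3 = S -> A2 :&: A3 = S ->
  #|S| = m.-1 -> #|A| <= m ->
  m.-1 <= #|A :&: A1| -> m.-1 <= #|A :&: A2| -> m.-1 <= #|A :&: A3| ->
  S \subset A.
Proof.
move=> e12 e13 e23 cardS cardA c1 c2 c3.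
have count : #|A :&: A1 :|: A :&: A2 :|: A :&: A3| + #|A :&: S| + #|A :&: S| =
             #|A :&: A1| + #|A :&: A2| + #|A :&: A3|.
  by apply: card_sunflower3; rewrite -setIIr ?e12 ?e13 ?e23.
have leA : #|A :&: A1 :|: A :&: A2 :|: A :&: A3| <= #|A|.
  by apply: subset_leq_card; rewrite !subUset !subsetIl.
apply/setIidPr/eqP; rewrite eqEcard subsetIr cardS /=; lia.
Qed.

Lemma johnson_clique_cardI (n m : nat) (V : finType) (nu : V -> msubset n m)
    (H : {set V}) (u v : V) :
  clique (johnson_adj nu) H -> u \in H -> v \in H -> u != v ->
  #|val (nu u) :&: val (nu v)| = m.-1.
Proof.
move=> /forall_inP cliqueH uH vH uv.
have /forall_inP/(_ v vH)/implyP/(_ uv) := cliqueH u uH.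
by case/andP=> _ /eqP.
Qed.

Theorem proposition3p2 (n m : nat) (hm : 1 <= m <= n)
    (V : finType) (nu : V -> msubset n m) (nu_bij : bijective nu)
    (H : {set V}) (maxH : maximal_clique (johnson_adj nu) H)
    (v1 v2 v3 : V) (v1H : v1 \in H) (v2H : v2 \in H) (v3H : v3 \in H)
    (v12 : v1 != v2) (v13 : v1 != v3) (v23 : v2 != v3)
    (card123 : #|val (nu v1) :&: val (nu v2) :&: val (nu v3)| = m.-1) :
  \bigcap_(v in H) val (nu v) = val (nu v1) :&: val (nu v2).
Proof.
have cliqueH : clique (johnson_adj nu) H by case/maxsetP: maxH.
have cardI u v := @johnson_clique_cardI n m V nu H u v cliqueH.
have meetH u v : u \in H -> v \in H -> m.-1 <= #|val (nu u) :&: val (nu v)|.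
  move=> uH vH; have [<-|uv] := eqVneq u v; last by rewrite cardI.
  by rewrite setIid (eqP (valP (nu u))) leq_pred.
set S123 := _ :&: _ :&: val (nu v3) in card123.
(* Each pairwise intersection contains S123 and has the same cardinality. *)
have pairE u v : u \in H -> v \in H -> u != v ->
    S123 \subset val (nu u) :&: val (nu v) -> val (nu u) :&: val (nu v) = S123.
  move=> uH vH uv sub; apply/esym/eqP.
  by rewrite eqEcard sub (cardI u v) // card123 /=.
have [s1 s2 s3] : [/\ S123 \subset val (nu v1), S123 \subset val (nu v2)
                    & S123 \subset val (nu v3)].
  by split; apply/subsetP=> x; rewrite !inE => /andP[/andP[]].
have e12 : val (nu v1) :&: val (nu v2) = S123.
  by apply: pairE; rewrite // subsetI s1.
have e13 : val (nu v1) :&: val (nu v3) = S123.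
  by apply: pairE; rewrite // subsetI s1.
have e23 : val (nu v2) :&: val (nu v3) = S123.
  by apply: pairE; rewrite // subsetI s2.
apply/eqP; rewrite eqEsubset subsetI !bigcap_inf //= e12.
apply/bigcapsP=> v vH.
apply: (sunflower3_kernel_sub _ _ _ _ _ _ _ e12 e13 e23 card123).
- by rewrite (eqP (valP (nu v))).
- exact: meetH.
- exact: meetH.
- exact: meetH.
Qed.
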